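(* Let $\mathrm{Pnest}_{\mathcal N_2(0)}(t)=1$ and $\mathrm{Pnest}^c_{\mathcal N_2(0)}(t)=0$. For $n\ge1$ let $\mathrm{Pnest}_{\mathcal N_2(n)}(t)=\sum t^{\mathrm{pnest}(\mathbf a)}$, the sum being over all area sequences $\mathbf a$ of size $n$ with $\mathrm{pnest}(\mathbf a)\le2$, and let $\mathrm{Pnest}^c_{\mathcal N_2(n)}(t)$ be the same sum restricted to those $\mathbf a$ for which $\Gamma_{\mathbf a}$ is connected. Then $\mathrm{Pnest}_{\mathcal N_2(n)}(t)$ and $\mathrm{Pnest}^c_{\mathcal N_2(n)}(t)$ are real-rooted for every $n\ge0$, and the sequences $\{\mathrm{Pnest}_{\mathcal N_2(n)}(t)\}_{n\ge0}$ and $\{\mathrm{Pnest}^c_{\mathcal N_2(n)}(t)\}_{n\ge0}$ are generalized Sturm sequences.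
   Context: Write $[n]=\{1,\dots,n\}$. An area sequence of size $n$ is a sequence $\mathbf a=(a_1,\dots,a_n)$ of nonnegative integers with $a_i<i$ for all $i$ and $a_i\le a_{i-1}+1$ for all $i\ge 2$. It defines a graph $\Gamma_{\mathbf a}$ (a unit interval graph) on $[n]$ with edges $\{j,i\}$ for $1\le j<i\le n$ with $i-a_i\le j$. If $\{i,j\}$ with $i<j$ is an edge then $\{i,i+1,\dots,j\}$ is a clique. A peak-edge of $\Gamma_{\mathbf a}$ is either an isolated vertex $i$ (put $j=i$) or an edge $\{i,j\}$, $i<j$, such that neither $\{i,j+1\}$ nor $\{i-1,j\}$ is an edge (pairs not contained in $[n]$ are not edges). The corresponding peak-clique is $\{i,\dots,j\}$. The peak-nesting of a vertex is the number of peak-cliques containing it, and $\mathrm{pnest}(\mathbf a)$ is the maximum over all vertices. ($\Gamma_{\mathbf a}$ is called $2$-nested if $\mathrm{pnest}(\mathbf a)\le2$.) A real polynomial is real-rooted if all its zeros are real (constants, including $0$, are real-rooted). For real-rooted $f,g$ with positive leading coefficients and zeros (with multiplicity) $\cdots\le\lambda_2\le\lambda_1$ and $\cdots\le\delta_2\le\delta_1$ respectively, write $g\ll f$ if $\cdots\le\delta_2\le\lambda_2\le\delta_1\le\lambda_1$ (so the degrees differ by at most one, $\deg g\le\deg f$); by convention also $0\ll0$, $0\ll f$, $f\ll0$. A sequence $\{f_i\}_{i\ge0}$ of real-rooted polynomials with positive leading coefficients (the zero polynomial being allowed under this convention) is a generalized Sturm sequence if $f_{i-1}\ll f_i$ for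 all $i\ge1$. *)

(* Defs.v *)
From mathcomp Require Import all_boot all_order all_algebra.
From mathcomp Require Import reals.
From mathcomp Require Import complex.

Set Implicit Arguments.
Unset Strict Implicit.
Unset Printing Implicit Defensive.

Import Order.TTheory GRing.Theory Num.Theory.

Local Open Scope nat_scope.

(* The vertex i of [n] = {1, ..., n} is the ordinal of value i - 1 in 'I_n.
   Under this shift the condition a_i < i reads [a i <= i]; it bounds every
   entry by n - 1, so {ffun 'I_n -> 'I_n} contains all area sequences. *)
Definition area_seq n (a : {ffun 'I_n -> 'I_n}) : bool :=
  [forall i, a i <= i] &&
  [forall i : 'I_n, forall j : 'I_n,
     (j == i.+1 :> nat) ==> (a j <= (a i).+1)].

Definition edge n (a : {ffun 'I_n -> 'I_n}) : rel 'I_n := fun u v =>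
  (u < v) && (v <= u + a v) || (v < u) && (u <= v + a u).

Definition isolated n (a : {ffun 'I_n -> 'I_n}) (i : 'I_n) : bool :=
  [forall j, ~~ edge a i j].

(* A neighbour i - 1 or j + 1 outside [n] gives an empty quantification. *)
Definition peak_edge n (a : {ffun 'I_n -> 'I_n}) (i j : 'I_n) : bool :=
  (i == j) && isolated a i ||
  [&& i < j, edge a i j,
      [forall k : 'I_n, (k == j.+1 :> nat) ==> ~~ edge a i k] &
      [forall k : 'I_n, (k.+1 == i :> nat) ==> ~~ edge a k j]].

Definition interval n (i j : 'I_n) : {set 'I_n} :=
  [set k : 'I_n | i <= k <= j].

Definition peak_cliques n (a : {ffun 'I_n -> 'I_n}) : {set {set 'I_n}} :=
  [set interval p.1 p.2 | p : 'I_n * 'I_n & peak_edge a p.1 p.2].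

Definition peak_nesting n (a : {ffun 'I_n -> 'I_n}) (v : 'I_n) : nat :=
  #|[set C in peak_cliques a | v \in C]|.

Definition pnest n (a : {ffun 'I_n -> 'I_n}) : nat :=
  \max_(v < n) peak_nesting a v.

Definition connected_graph n (a : {ffun 'I_n -> 'I_n}) : bool :=
  [forall u, forall v, connect (edge a) u v].

Local Open Scope ring_scope.

Definition Pnest2 (R : realType) (n : nat) : {poly R} :=
  if n == 0%N then 1
  else \sum_(a : {ffun 'I_n -> 'I_n} | area_seq a && (pnest a <= 2)%N)
         'X^(pnest a).

Definition Pnest2c (R : realType) (n : nat) : {poly R} :=
  if n == 0%N then 0
  else \sum_(a : {ffun 'I_n -> 'I_n} |
               [&& area_seq a, (pnest a <= 2)%N & connected_graph a])
         'X^(pnest a).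

Definition real_rooted (R : realType) (p : {poly R}) : Prop :=
  p != 0 ->
  forall z : R[i], root (map_poly (real_complex R) p) z -> complex.Im z = 0.

Definition zeros_of (R : realType) (p : {poly R}) (s : seq R) : Prop :=
  sorted >=%R s /\ forall x, count_mem x s = mup x p.

(* With d = (delta_1, delta_2, ...) and l = (lambda_1, lambda_2, ...):
   ... <= delta_2 <= lambda_2 <= delta_1 <= lambda_1. *)
Definition interlacing (R : realType) (d l : seq R) : Prop :=
  [/\ (size d <= size l <= (size d).+1)%N,
      forall i, (i < size d)%N -> d`_i <= l`_i &
      forall i, (i.+1 < size l)%N -> l`_i.+1 <= d`_i].

(* Real-rooted with positive leading coefficient, or zero. *)
Definition admissible (R : realType) (p : {poly R}) : Prop :=
  real_rooted p /\ (p = 0 \/ 0 < lead_coef p).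

(* The relation g << f; it holds by convention if g or f is zero. *)
Definition interlaces (R : realType) (g f : {poly R}) : Prop :=
  [/\ admissible g, admissible f &
      g != 0 -> f != 0 ->
      exists d l, [/\ zeros_of g d, zeros_of f l & interlacing d l]].

Definition generalized_Sturm (R : realType) (f : nat -> {poly R}) : Prop :=
  (forall i, admissible (f i)) /\
  (forall i, (1 <= i)%N -> interlaces (f i.-1) (f i)).

(* Main.v *)
(* For [n >= 1] both polynomials have the form [alpha_n X + beta_n X^2], with
   roots [0] and [- alpha_n / beta_n], so everything reduces to
   [beta_n alpha_(n+1) <= beta_(n+1) alpha_n].  Adding an isolated vertex at the
   right end, or duplicating the last vertex, preserves the peak-nesting; these
   two injections have disjoint images, which together contain every graph of
   peak-nesting 1.  Hence [beta_(n+1) >= 2 beta_n] and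
   [alpha_(n+1) <= 2 alpha_n].  In the connected case only the duplication is
   available, and both factors become 1. *)
Require Import Defs.
From mathcomp Require Import all_boot all_order all_algebra.
From mathcomp Require Import reals.
From mathcomp Require Import complex zify ring.

Set Implicit Arguments.
Unset Strict Implicit.
Unset Printing Implicit Defensive.

Import Order.TTheory GRing.Theory Num.Theory.

Local Open Scope nat_scope.

(* Extending by [0] past the end makes the last vertex satisfy the descent
   condition [area_ext a j.+1 <= area_ext a j] that marks right peak ends. *)
Definition area_ext n (a : {ffun 'I_n -> 'I_n}) (k : nat) : nat :=
  if insub k is Some i then a i else 0.

Lemma area_extE n (a : {ffun 'I_n -> 'I_n}) (i : 'I_n) : area_ext a i = a i.
Proof. by rewrite /area_ext valK. Qed.

Lemma area_ext_out n (a : {ffun 'I_n -> 'I_n}) k : n <= k -> area_ext a k = 0.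
Proof. by move=> le_nk; rewrite /area_ext insubF // ltnNge le_nk. Qed.

Lemma area_ext_inj n (a b : {ffun 'I_n -> 'I_n}) :
  area_ext a =1 area_ext b -> a = b.
Proof. by move=> eq_ab; apply/ffunP=> i; apply/val_inj; rewrite /= -!area_extE. Qed.

(** The bounds [a i <= i] follow by induction from the one at [0], and beyond the last vertex the
    growth condition is free because the extension is [0] there. *)
Lemma area_seqP n (a : {ffun 'I_n -> 'I_n}) :
  reflect (area_ext a 0 = 0 /\
           forall k, area_ext a k.+1 <= (area_ext a k).+1) (area_seq a).
Proof.
apply: (iffP andP) => [[/forallP a_le /forallP aS]|[a0 aS]].
  split=> [|k].
    case: n => [|n] in a a_le aS *; first by rewrite area_ext_out.
    by apply/eqP; have := a_le ord0; rewrite -area_extE leqn0.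
  have [lt_kn|le_nk] := ltnP k.+1 n; last by rewrite area_ext_out.
  have /forallP/(_ (Ordinal lt_kn))/implyP/(_ (eqxx _)) := aS (Ordinal (ltnW lt_kn)).
  by rewrite -!area_extE.
split; apply/forallP=> i.
  rewrite -area_extE; case: i => k _ /=.
  by elim: k => [|k IHk]; rewrite ?a0 // (leq_trans (aS k)).
by apply/forallP=> j; apply/implyP=> /eqP ji; rewrite -!area_extE ji aS.
Qed.

(** * Edges, peaks, nesting and connectivity read off the area sequence *)

Section AreaSequence.
Variables (n : nat) (a : {ffun 'I_n -> 'I_n}).
Hypothesis area_a : area_seq a.

Lemma area_ext0 : area_ext a 0 = 0.
Proof. by have /area_seqP[] := area_a. Qed.

Lemma area_extS k : area_ext a k.+1 <= (area_ext a k).+1.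
Proof. by have /area_seqP[_ ->] := area_a. Qed.

Lemma area_ext_le k : area_ext a k <= k.
Proof.
by elim: k => [|k IHk]; rewrite ?area_ext0 // (leq_trans (area_extS k)).
Qed.

(* The left end [k - a_k] of the neighbourhood of [k] is nondecreasing. *)
Lemma area_ext_left k l : k <= l -> k + area_ext a l <= l + area_ext a k.
Proof.
move=> /subnKC <-; elim: (l - k) => [|d IHd]; first by rewrite addn0.
by have := area_extS (k + d); rewrite addnS; lia.
Qed.

Lemma edge_lt (i j : 'I_n) : i < j -> edge a i j = (j <= i + area_ext a j).
Proof. by move=> lt_ij; rewrite /edge lt_ij ltnNge (ltnW lt_ij) orbF area_extE. Qed.

(** Since left ends are nondecreasing, a vertex with any neighbour is adjacent to its predecessor or
    to its successor, so only these two edges have to be excluded. *)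
Lemma isolatedE (i : 'I_n) :
  isolated a i = (area_ext a i == 0) && (area_ext a i.+1 == 0).
Proof.
have le_i := area_ext_le i.
apply/forallP/andP => [iso|[/eqP ai0 /eqP aS0] j].
  split.
    have [i0|i_gt0] := posnP i; first by rewrite i0 area_ext0.
    have lt_i : i.-1 < n by have := ltn_ord i; lia.
    have := iso (Ordinal lt_i); rewrite /edge -!area_extE /=; lia.
  have [lt_Si|le_n] := ltnP i.+1 n; last by rewrite area_ext_out.
  have := iso (Ordinal lt_Si); rewrite edge_lt //=; lia.
have := @area_ext_left i.+1 j; have := area_ext_left (ltnW (ltnSn i)).
rewrite /edge -!area_extE ai0 aS0; lia.
Qed.

(** Maximality on the left pins [i] to the left end [j - a_j]; maximality on the right then says
    that the left end moves strictly at [j + 1]. The case [a_j = 0] is the isolated vertex, so a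
    peak edge is determined by its right end. *)
Lemma peak_edgeE (i j : 'I_n) :
  peak_edge a i j =
    (i + area_ext a j == j) && (area_ext a j.+1 <= area_ext a j).
Proof.
have le_j := area_ext_le j; rewrite /peak_edge isolatedE -val_eqE /=.
have [lt_ij|lt_ji|eq_ij] := ltngtP i j; last first.
- rewrite orbF eq_ij; lia.
- rewrite /=; lia.
rewrite edge_lt //=.
have -> : [forall k : 'I_n, (k == j.+1 :> nat) ==> ~~ edge a i k] =
          (i + area_ext a j.+1 <= j).
  apply/forallP/idP => [noedge|le_k k].
    have [lt_Sj|le_n] := ltnP j.+1 n; last by rewrite area_ext_out // addn0 ltnW.
    have := noedge (Ordinal lt_Sj); rewrite eqxx edge_lt //=; lia.
  by apply/implyP=> /eqP kj; rewrite edge_lt kj; lia.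
have -> : [forall k : 'I_n, (k.+1 == i :> nat) ==> ~~ edge a k j] =
          (i + area_ext a j <= j).
  apply/forallP/idP => [noedge|le_k k].
    have [i0|i_gt0] := posnP i; first by rewrite i0.
    have lt_i : i.-1 < n by have := ltn_ord i; lia.
    have := noedge (Ordinal lt_i); rewrite /= prednK // eqxx edge_lt /=; lia.
  by apply/implyP=> /eqP ki; rewrite edge_lt; lia.
lia.
Qed.

(** Peak-cliques correspond bijectively to their right ends, so counting cliques through [v] amounts
    to counting right ends [j] with [j - a_j <= v <= j]. *)
Lemma peak_nestingE (v : 'I_n) :
  peak_nesting a v =
    \sum_(j < n) ((v <= j <= v + area_ext a j) &&
                  (area_ext a j.+1 <= area_ext a j)).
Proof.
rewrite /peak_nesting -sum1dep_card big_mkcond /=.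
pose clique (j : 'I_n) := [set k : 'I_n | j - area_ext a j <= k <= j].
pose J := [set j : 'I_n | (v <= j <= v + area_ext a j) &&
                          (area_ext a j.+1 <= area_ext a j)].
have clique_inj : injective clique.
  (* The vertex [i] lies in its own clique, hence in that of [j], whose maximum is [j]. *)
  suff le_inj i j : clique i = clique j -> i <= j.
    by move=> i j eqc; apply/val_inj/eqP; rewrite eqn_leq !le_inj.
  by move=> /setP/(_ i); rewrite !inE; lia.
have -> : \sum_(j < n) ((v <= j <= v + area_ext a j) &&
            (area_ext a j.+1 <= area_ext a j)) = #|J|.
  by rewrite -sum1_card [RHS]big_mkcond /=; apply: eq_bigr => j _; rewrite inE.
rewrite -(card_imset (mem J) clique_inj) -sum1_card [RHS]big_mkcond /=.
apply: eq_bigr => C _; congr (if _ then _ else _).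
apply/andP/imsetP => [[/imsetP[[i j]]]|[j]].
  rewrite inE peak_edgeE /= => /andP[/eqP eij le_Sj] -> vC.
  exists j; first by move: vC; rewrite !inE le_Sj; lia.
  by apply/setP=> k; rewrite !inE; lia.
rewrite inE => /andP[vj le_Sj] ->.
have lt_i : j - area_ext a j < n by have := ltn_ord j; lia.
have le_j := area_ext_le j.
split; last by rewrite inE; lia.
apply/imsetP; exists (Ordinal lt_i, j) => //=.
by rewrite inE /= peak_edgeE /= subnK // eqxx.
Qed.

(** A zero entry at [i > 0] leaves no edge between the vertices below [i] and the others; if there
    is none, consecutive vertices are adjacent. *)
Lemma connected_graphE :
  connected_graph a = [forall i : 'I_n, (0 < i) ==> (0 < area_ext a i)].
Proof.
apply/forallP/forallP => [conn i|a_gt0 u].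
  apply/implyP=> i_gt0; rewrite lt0n; apply/eqP=> ai0.
  have lt0 : 0 < n by have := ltn_ord i; lia.
  have /forallP/(_ i) := conn (Ordinal lt0).
  suff cl : closed (edge a) [pred v : 'I_n | v < i].
    by move=> /(closed_connect cl); rewrite !inE /= ltnn i_gt0.
  move=> x y; rewrite /edge -!area_extE !inE.
  by have := @area_ext_left i x; have := @area_ext_left i y; lia.
have edge_sym : symmetric (edge a) by move=> x y; rewrite /edge orbC.
have csym := sym_connect_sym edge_sym.
have lt0 : 0 < n by have := ltn_ord u; lia.
suff conn0 (v : 'I_n) : connect (edge a) (Ordinal lt0) v.
  by apply/forallP=> v; rewrite (connect_trans _ (conn0 v)) // csym.
case: v => k; elim: k => [|k IHk] lt_k.
  by rewrite (_ : Ordinal lt_k = Ordinal lt0) ?connect0 //; apply/val_inj.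
apply: connect_trans (IHk (ltnW lt_k)) (connect1 _).
by have := a_gt0 (Ordinal lt_k); rewrite edge_lt //=; lia.
Qed.

End AreaSequence.

(** Only the last vertex can serve as right end here, and it always is one since the extension
    vanishes after it. *)
Lemma peak_nesting_ord_max n (a : {ffun 'I_n.+1 -> 'I_n.+1}) :
  area_seq a -> peak_nesting a ord_max = 1.
Proof.
move=> area_a; rewrite peak_nestingE // big_ord_recr big1 /= => [|j _].
  by rewrite leqnn leq_addr area_ext_out.
by rewrite leqNgt ltn_ord.
Qed.

Lemma pnest_gt0 n (a : {ffun 'I_n.+1 -> 'I_n.+1}) : area_seq a -> 0 < pnest a.
Proof.
move=> area_a; rewrite -(peak_nesting_ord_max area_a).
exact: (leq_bigmax (F := peak_nesting a)).
Qed.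

Lemma pnest_ord1 (a : {ffun 'I_1 -> 'I_1}) : area_seq a -> pnest a = 1.
Proof.
by move=> /peak_nesting_ord_max; rewrite /pnest big_ord1 [ord_max]ord1.
Qed.

(** * Adding an isolated vertex and duplicating the last vertex *)

Definition append n (a : {ffun 'I_n -> 'I_n}) (c : nat) :
    {ffun 'I_n.+1 -> 'I_n.+1} :=
  [ffun i : 'I_n.+1 => inord (if i == n :> nat then c else area_ext a i)].

Lemma area_ext_lt n (a : {ffun 'I_n -> 'I_n}) k : area_ext a k < n.+1.
Proof. by rewrite /area_ext; case: insubP => // i _ _; rewrite ltnW ?ltnS. Qed.

Lemma area_ext_append n (a : {ffun 'I_n -> 'I_n}) c k : c <= n ->
  area_ext (append a c) k = if k == n then c else area_ext a k.
Proof.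
move=> le_cn; have [lt_k|le_nk] := ltnP k n.+1; last first.
  by rewrite gtn_eqF // !area_ext_out // ltnW.
rewrite -[k]/(val (Ordinal lt_k)) area_extE ffunE /= inordK //.
by case: eqP => // _; apply: area_ext_lt.
Qed.

Lemma append_inj n (a b : {ffun 'I_n -> 'I_n}) c d : c <= n -> d <= n ->
  append a c = append b d -> a = b /\ c = d.
Proof.
move=> le_c le_d eq_ab.
have eq_ext k : area_ext (append a c) k = area_ext (append b d) k by rewrite eq_ab.
split; last by have := eq_ext n; rewrite !area_ext_append // eqxx.
apply: area_ext_inj => k; have := eq_ext k; rewrite !area_ext_append //.
by case: eqP => // ->; rewrite !area_ext_out.
Qed.

Section Append.
Variables (n : nat) (a : {ffun 'I_n.+1 -> 'I_n.+1}).

Definition isolate := append a 0.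
Definition double := append a (area_ext a n).+1.

Lemma area_ext_isolate : area_ext isolate =1 area_ext a.
Proof.
by move=> k; rewrite area_ext_append //; case: eqP => // ->; rewrite area_ext_out.
Qed.

Hypothesis area_a : area_seq a.

Lemma area_ext_double k :
  area_ext double k = if k == n.+1 then (area_ext a n).+1 else area_ext a k.
Proof. by rewrite area_ext_append // ltnS area_ext_le. Qed.

Lemma area_isolate : area_seq isolate.
Proof.
by apply/area_seqP; split=> [|k]; rewrite !area_ext_isolate ?area_ext0 ?area_extS.
Qed.

Lemma area_double : area_seq double.
Proof.
apply/area_seqP; split=> [|k]; rewrite !area_ext_double ?area_ext0 //.
case: (eqVneq k.+1 n.+1) => [[->]|_]; first by rewrite ltn_eqF.
by case: eqP => [->|_]; rewrite ?area_extS // [area_ext _ n.+2]area_ext_out.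
Qed.

(** Old vertices keep their nesting; the new one has nesting 1, which the maximum absorbs because
    [pnest a] is positive. *)
Lemma pnest_isolate : pnest isolate = pnest a.
Proof.
rewrite /pnest big_ord_recr /= (peak_nesting_ord_max area_isolate).
rewrite (eq_bigr (peak_nesting a)) => [|v _].
  exact/maxn_idPl/pnest_gt0.
rewrite !peak_nestingE ?area_isolate // big_ord_recr /= area_ext_isolate.
rewrite (@area_ext_out _ a n.+1) // -[RHS]addn0; congr (_ + _).
  by apply: eq_bigr => j _; rewrite !area_ext_isolate.
have := ltn_ord v; lia.
Qed.

(** The last peak-clique is extended by the new vertex and keeps its left end, while the other
    peak-cliques are unchanged. *)
Lemma pnest_double : pnest double = pnest a.
Proof.
rewrite /pnest big_ord_recr /= (peak_nesting_ord_max area_double).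
rewrite (eq_bigr (peak_nesting a)) => [|v _].
  exact/maxn_idPl/pnest_gt0.
rewrite !peak_nestingE ?area_double // 2!big_ord_recr [RHS]big_ord_recr /=.
(* The term of the new right end equals the one of the old last vertex. *)
have lt_v := ltn_ord v; congr (_ + _); last first.
  rewrite !area_ext_double eqxx gtn_eqF //.
  rewrite [area_ext a n.+1]area_ext_out // [area_ext a n.+2]area_ext_out //; lia.
(* The old last vertex is followed by a larger entry, so it is no longer a right end. *)
rewrite -[RHS]addn0; congr (_ + _); last first.
  by rewrite !area_ext_double eqxx ltn_eqF // ltnn andbF.
apply: eq_bigr => j _; rewrite !area_ext_double.
by have := ltn_ord j; do 2!case: eqP; lia.
Qed.

Lemma connected_double : connected_graph double = connected_graph a.
Proof.
rewrite !connected_graphE ?area_double //.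
apply/forallP/forallP => a_gt0 i.
  have := a_gt0 (widen_ord (leqnSn _) i); rewrite area_ext_double /=.
  by rewrite ltn_eqF.
rewrite area_ext_double; case: eqP => [//|ne]; first by rewrite implybT.
have lt_i : i < n.+1 by have := ltn_ord i; lia.
exact: a_gt0 (Ordinal lt_i).
Qed.

End Append.

Lemma isolate_inj n : injective (@isolate n).
Proof. by move=> a b /append_inj[]. Qed.

Lemma double_inj n : {in @area_seq n.+1 &, injective (@double n)}.
Proof.
by move=> a b area_a area_b /append_inj[]; rewrite ?ltnS ?area_ext_le.
Qed.

Lemma isolate_neq_double n (a b : {ffun 'I_n.+1 -> 'I_n.+1}) :
  area_seq b -> isolate a != double b.
Proof.
by move=> area_b; apply/eqP=> /append_inj[]; rewrite ?ltnS ?area_ext_le.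
Qed.

(* If [0 < b_(n+1) <= b_n], the vertex [n] lies in the peak cliques ending at
   [n] and at [n + 1]. *)
Lemma pnest1P n (b : {ffun 'I_n.+2 -> 'I_n.+2}) :
  area_seq b -> pnest b = 1 ->
  exists2 a, area_seq a & b = isolate a \/ b = double a.
Proof.
move=> area_b pb1.
pose a := [ffun i : 'I_n.+1 => inord (area_ext b i) : 'I_n.+1].
have aE k : area_ext a k = if k < n.+1 then area_ext b k else 0.
  case: ifP => [lt_k|]; last by move/negbT; rewrite -leqNgt => /area_ext_out.
  rewrite -[k]/(val (Ordinal lt_k)) area_extE ffunE inordK //=.
  exact: leq_ltn_trans (area_ext_le area_b k) lt_k.
have area_a : area_seq a.
  apply/area_seqP; split=> [|k]; rewrite !aE ?area_ext0 //.
  by have := area_extS area_b k; do 2![case: ifP]; lia.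
have: peak_nesting b (inord n) <= 1 by rewrite -pb1; exact: leq_bigmax.
rewrite peak_nestingE // 2!big_ord_recr /= inordK //.
rewrite (@area_ext_out _ b n.+2) // => nest_le.
have b_le := area_extS area_b n.
have /orP[/eqP b0|/eqP bS] :
    (area_ext b n.+1 == 0) || (area_ext b n.+1 == (area_ext b n).+1) by lia.
  exists a => //; left; apply: area_ext_inj => k.
  rewrite area_ext_isolate aE; case: ltngtP => // [lt_k|->//].
  by rewrite area_ext_out.
exists a => //; right; apply: area_ext_inj => k.
rewrite area_ext_double // !aE ltnSn; case: ltngtP => // [lt_k|->//].
by rewrite area_ext_out.
Qed.

(** * Growth of the numbers of area sequences with given peak-nesting *)

Definition areas_pnest n k : {set {ffun 'I_n -> 'I_n}} :=
  [set a | area_seq a && (pnest a == k)].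

Definition connected_areas_pnest n k : {set {ffun 'I_n -> 'I_n}} :=
  [set a in areas_pnest n k | connected_graph a].

Lemma double_inj_areas n k : {in areas_pnest n.+1 k &, injective (@double n)}.
Proof.
by move=> a b; rewrite !inE => /andP[aa _] /andP[ab _]; apply: double_inj.
Qed.

Lemma card_isolate_double n k :
  #|@isolate n @: areas_pnest n.+1 k :|: @double n @: areas_pnest n.+1 k| =
  2 * #|areas_pnest n.+1 k|.
Proof.
rewrite cardsU (card_imset _ (@isolate_inj n)) card_in_imset; last first.
  exact: double_inj_areas.
rewrite [X in _ - X](_ : _ = 0) ?subn0 ?mul2n ?addnn //.
apply/eqP; rewrite cards_eq0; apply/set0Pn=> -[_ /setIP[/imsetP[a _ ->]]].
case/imsetP=> b; rewrite inE => /andP[area_b _] /eqP.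
by rewrite (negbTE (isolate_neq_double _ area_b)).
Qed.

Lemma card_areas_pnest_ge n k :
  2 * #|areas_pnest n.+1 k| <= #|areas_pnest n.+2 k|.
Proof.
rewrite -card_isolate_double; apply/subset_leq_card/subsetP=> b.
case/setUP=> /imsetP[a]; rewrite !inE => /andP[area_a pa] ->.
  by rewrite area_isolate // pnest_isolate.
by rewrite area_double // pnest_double.
Qed.

Lemma card_areas_pnest1_le n :
  #|areas_pnest n.+2 1| <= 2 * #|areas_pnest n.+1 1|.
Proof.
rewrite -card_isolate_double; apply/subset_leq_card/subsetP=> b.
rewrite inE => /andP[area_b /eqP pb1].
have [a area_a [] eb] := pnest1P area_b pb1; apply/setUP; [left|right];
  rewrite eb; apply: imset_f; rewrite inE area_a -pb1 eb.
  by rewrite pnest_isolate ?eqxx.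
by rewrite pnest_double ?eqxx.
Qed.

Lemma card_connected_areas_pnest_ge n k :
  #|connected_areas_pnest n.+1 k| <= #|connected_areas_pnest n.+2 k|.
Proof.
rewrite -(card_in_imset (f := @double n)); last first.
  move=> a b; rewrite !inE => /andP[/andP[aa _] _] /andP[/andP[ab _] _].
  exact: double_inj.
apply/subset_leq_card/subsetP=> _ /imsetP[a + ->].
rewrite !inE => /andP[/andP[area_a pa] ca].
by rewrite area_double // pnest_double // pa connected_double.
Qed.

Lemma card_connected_areas_pnest1_le n :
  #|connected_areas_pnest n.+2 1| <= #|connected_areas_pnest n.+1 1|.
Proof.
apply: leq_trans (leq_imset_card (@double n) _).
apply/subset_leq_card/subsetP=> b.
rewrite !inE => /andP[/andP[area_b /eqP pb1] cb].
have [a area_a [] eb] := pnest1P area_b pb1; last first.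
  rewrite eb; apply: imset_f.
  by rewrite !inE area_a -connected_double // -pnest_double // -eb pb1 cb.
(* An isolated last vertex has entry [0], which contradicts connectivity. *)
move: cb; rewrite eb connected_graphE ?area_isolate // => /forallP/(_ ord_max).
by rewrite area_ext_isolate area_ext_out.
Qed.

Lemma areas_pnest_ord1 : areas_pnest 1 2 = set0.
Proof.
apply/setP=> a; rewrite !inE; apply/negP=> /andP[area_a].
by rewrite pnest_ord1.
Qed.

(** * Coefficients of the generating polynomials *)

Local Open Scope ring_scope.

(** Positivity of [pnest] leaves only the exponents 1 and 2. The predicate [P] lets one computation
    serve both families. *)
Lemma sum_pnest_le2 (R : nzRingType) n (P : pred {ffun 'I_n.+1 -> 'I_n.+1}) :
  \sum_(a | [&& area_seq a, (pnest a <= 2)%N & P a]) 'X^(pnest a) =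
  #|[set a in areas_pnest n.+1 1 | P a]|%:R *: 'X +
  #|[set a in areas_pnest n.+1 2 | P a]|%:R *: 'X^2 :> {poly R}.
Proof.
rewrite (bigID (fun a => pnest a == 1%N)) /=; congr (_ + _).
  rewrite scaler_nat -sumr_const; apply: eq_big => [a|a /andP[_ /eqP->]].
    rewrite !inE; case: (area_seq a) (P a) => [] []; rewrite //=; lia.
  by rewrite expr1.
rewrite scaler_nat -sumr_const; apply: eq_big => [a|a].
  rewrite !inE; case area_a : (area_seq a) => //=.
  have := pnest_gt0 area_a; case: (P a); rewrite ?andbF //=; lia.
case/andP=> /and3P[/pnest_gt0 p_gt0 p_le2 _] p_neq1.
by have -> : pnest a = 2%N by lia.
Qed.

Lemma Pnest2E (R : realType) n :
  Pnest2 R n.+1 = #|areas_pnest n.+1 1|%:R *: 'X +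
                  #|areas_pnest n.+1 2|%:R *: 'X^2.
Proof.
rewrite /Pnest2 /=.
under eq_bigl => a do rewrite -[(_ <= 2)%N]andbT.
rewrite (sum_pnest_le2 _ predT); congr (_%:R *: _ + _%:R *: _);
  by apply: eq_card => a; rewrite !inE andbT.
Qed.

Lemma Pnest2cE (R : realType) n :
  Pnest2c R n.+1 = #|connected_areas_pnest n.+1 1|%:R *: 'X +
                   #|connected_areas_pnest n.+1 2|%:R *: 'X^2.
Proof. exact: sum_pnest_le2. Qed.

(** * Interlacing of polynomials given by their root lists *)

Section Interlacing.
Variable R : realType.
Implicit Types (p : {poly R}) (c : R) (s : seq R).

Lemma admissible_split c s :
  0 < c -> admissible (c *: \prod_(r <- s) ('X - r%:P)).
Proof.
move=> c_gt0; split; last first.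
  by right; rewrite lead_coefZ (monicP (monic_prod_XsubC _ _ _)) mulr1.
move=> _ z; rewrite map_polyZ /= rootZ ?fmorph_eq0 ?gt_eqF //.
rewrite map_prod_XsubC -(big_map _ xpredT (fun r => 'X - r%:P)).
by rewrite root_prod_XsubC => /mapP[r _ ->].
Qed.

Lemma admissible0 : @admissible R 0.
Proof. by split; [move/eqP|left]. Qed.

Lemma zeros_of_split c s : 0 < c -> sorted >=%R s ->
  zeros_of (c *: \prod_(r <- s) ('X - r%:P)) s.
Proof.
move=> c_gt0 sorted_s; split=> // x.
by rewrite -mul_polyC mupMr ?rootC ?gt_eqF // mu_prod_XsubC.
Qed.

Lemma interlaces_split c c' s s' : 0 < c -> 0 < c' ->
  sorted >=%R s -> sorted >=%R s' -> interlacing s s' ->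
  interlaces (c *: \prod_(r <- s) ('X - r%:P))
             (c' *: \prod_(r <- s') ('X - r%:P)).
Proof.
move=> c_gt0 c'_gt0 ss ss' ii; split; [exact: admissible_split..|].
by move=> _ _; exists s, s'; split; [exact: zeros_of_split..|].
Qed.

Lemma interlaces0r p : admissible p -> interlaces p 0.
Proof. by split=> //; [exact: admissible0|rewrite eqxx]. Qed.

Lemma interlaces0l p : admissible p -> interlaces 0 p.
Proof. by split=> //; [exact: admissible0|rewrite eqxx]. Qed.

Lemma linear_split (a : R) :
  a *: 'X + 0 *: 'X^2 = a *: \prod_(r <- [:: 0]) ('X - r%:P).
Proof. by rewrite scale0r addr0 big_seq1 subr0. Qed.

(** The value [a = 0] is allowed and gives a double root at [0]. *)
Lemma quadratic_split (a b : R) : b != 0 ->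
  a *: 'X + b *: 'X^2 = b *: \prod_(r <- [:: 0; - (a / b)]) ('X - r%:P).
Proof.
move=> b0; rewrite big_cons big_seq1 subr0 -!mul_polyC polyCN opprK.
rewrite polyCM !mulrDr [_ * ('X * (_ * _))](_ : _ = (b%:P * b^-1%:P) * (a%:P * 'X)).
  by rewrite -polyCM mulfV // mul1r addrC expr2.
ring.
Qed.

Lemma admissible_quadratic (a b : R) :
  0 <= a -> 0 <= b -> admissible (a *: 'X + b *: 'X^2).
Proof.
rewrite le0r => /orP[/eqP->|a_gt0]; rewrite le0r => /orP[/eqP->|b_gt0].
- by rewrite !scale0r addr0; apply: admissible0.
- by rewrite quadratic_split ?gt_eqF //; apply: admissible_split.
- by rewrite linear_split; apply: admissible_split.
- by rewrite quadratic_split ?gt_eqF //; apply: admissible_split.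
Qed.

(** For positive [b] and [b'] the last hypothesis compares the roots [- (a / b) <= - (a' / b')];
    with denominators cleared it also makes sense when a leading coefficient vanishes. *)
Lemma interlaces_quadratic (a b a' b' : R) :
  0 <= a -> 0 <= b -> 0 <= a' -> 0 <= b' -> b * a' <= b' * a ->
  interlaces (a *: 'X + b *: 'X^2) (a' *: 'X + b' *: 'X^2).
Proof.
move=> a_ge0 b_ge0 a'_ge0 b'_ge0 le_ba.
have adm := admissible_quadratic a_ge0 b_ge0.
have adm' := admissible_quadratic a'_ge0 b'_ge0.
have sorted_quad (x y : R) : 0 <= x -> 0 <= y -> sorted >=%R [:: 0; - (x / y)].
  by move=> x_ge0 y_ge0; rewrite /= andbT oppr_le0 divr_ge0.
move: (b_ge0) (b'_ge0); rewrite !le0r => /orP[/eqP b0|b_gt0] /orP[/eqP b'0|b'_gt0].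
- move: (a_ge0) (a'_ge0); rewrite !le0r => /orP[/eqP a0|a_gt0] /orP[/eqP a'0|a'_gt0].
  + by rewrite b0 a0 !scale0r addr0; apply: interlaces0l.
  + by rewrite b0 a0 !scale0r addr0; apply: interlaces0l.
  + by rewrite b'0 a'0 !scale0r addr0; apply: interlaces0r.
  + by rewrite b0 b'0 !linear_split; apply: interlaces_split.
- move: (a_ge0); rewrite le0r => /orP[/eqP a0|a_gt0].
    by rewrite b0 a0 !scale0r addr0; apply: interlaces0l.
  rewrite b0 linear_split quadratic_split ?gt_eqF //.
  apply: interlaces_split => //; first exact: sorted_quad.
  by split=> // -[|i] //= _; rewrite oppr_le0 divr_ge0.
(* The degree would drop from 2 to at most 1, but here the hypothesis reads [b * a' <= 0] and makes
   the second polynomial zero. *)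
- have : a' == 0.
    by rewrite eq_le a'_ge0 andbT -(pmulr_rle0 _ b_gt0) -[leRHS](mul0r a) -b'0.
  by move=> /eqP a'0; rewrite b'0 a'0 !scale0r addr0; apply: interlaces0r.
rewrite !quadratic_split ?gt_eqF //.
apply: interlaces_split => //; [exact: sorted_quad..|split=> //].
  case=> [|[|i]] //= _.
  by rewrite lerN2 ler_pdivrMr // mulrAC ler_pdivlMr // mulrC [leRHS]mulrC.
by case=> [|i] //= _; rewrite oppr_le0 divr_ge0.
Qed.

Lemma interlaces1X (a : R) : 0 <= a -> interlaces 1 (a *: 'X).
Proof.
have split1 : 1 = 1 *: \prod_(r <- [::]) ('X - r%:P) :> {poly R}.
  by rewrite big_nil scale1r.
rewrite le0r => /orP[/eqP->|a_gt0].
  by rewrite scale0r; apply: interlaces0r; rewrite split1; apply: admissible_split.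
rewrite split1 -[_ *: 'X]addr0 -[X in _ + X](scale0r 'X^2) linear_split.
by apply: interlaces_split => //; split=> // -[].
Qed.

End Interlacing.

Theorem corollary5p5 (R : realType) :
  (forall n : nat, real_rooted (Pnest2 R n) /\ real_rooted (Pnest2c R n)) /\
  generalized_Sturm (Pnest2 R) /\
  generalized_Sturm (Pnest2c R).
Proof.
have il n : interlaces (Pnest2 R n) (Pnest2 R n.+1).
  rewrite Pnest2E; case: n => [|n].
    (* A single vertex has peak-nesting 1, so the step from size 0 compares [1] with a multiple of
       ['X]. *)
    by rewrite areas_pnest_ord1 cards0 scale0r addr0; apply: interlaces1X.
  rewrite Pnest2E; apply: interlaces_quadratic; rewrite ?ler0n // -!natrM ler_nat.
  (* The factor 2 lost in the linear coefficient is regained in the quadratic one. *)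
  apply: leq_trans (leq_mul (leqnn _) (card_areas_pnest1_le n)) _.
  by rewrite mulnCA mulnA leq_mul ?card_areas_pnest_ge.
have ilc n : interlaces (Pnest2c R n) (Pnest2c R n.+1).
  rewrite Pnest2cE; case: n => [|n].
    (* The connected sequence starts at [0], where interlacing holds by convention. *)
    by apply/interlaces0l/admissible_quadratic; rewrite ler0n.
  rewrite Pnest2cE; apply: interlaces_quadratic; rewrite ?ler0n // -!natrM ler_nat.
  apply: leq_mul; first exact: card_connected_areas_pnest_ge.
  exact: card_connected_areas_pnest1_le.
have sturm f : (forall n, interlaces (f n) (f n.+1)) -> @generalized_Sturm R f.
  by move=> ilf; split=> [i|[|i] //]; have [] := ilf i.
split; last by split; apply: sturm.
by move=> n; have [[? _] _ _] := il n; have [[? _] _ _] := ilc n.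
Qed.
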